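(* Let $\eta>0$, let $G=(V,E)$ be a graph of arboricity at most $\alpha$, and set $\Lambda:=(1+1/\eta)\cdot2\alpha$. Let $H$ be any subgraph of $G$ with $G^\Lambda_{\le}\preceq H\preceq G$. If $C$ is a $(\beta,\zeta)$-approximate vertex cover of $H$, then $C\cup V^\Lambda_{>}$ is a vertex cover of $G$ of cardinality at most $(1+\beta+\eta)\,\mathrm{OPT}(G)+\zeta$.
   Context: $G^\Lambda_{\le}$ is the subgraph of $G$ induced by the vertices of degree (in $G$) at most $\Lambda$, and $V^\Lambda_{>}$ is the set of vertices of degree greater than $\Lambda$ in $G$. $\preceq$ denotes the subgraph relation. $\mathrm{OPT}(\cdot)$ is the size of a minimum vertex cover. $C$ is a $(\beta,\zeta)$-approximate vertex cover of $H$ if it is a vertex cover of $H$ with $|C|\le\beta\,\mathrm{OPT}(H)+\zeta$. Arboricity is the minimum number of forests partitioning the edges.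
   Formalization: The approximation factor β is assumed nonnegative; for negative β the claim can fail (a large star, H the edgeless graph on its leaves, C empty, ζ = 0). *)

(* Defs.v *)
From mathcomp Require Import all_boot all_order all_algebra.

Set Implicit Arguments.
Unset Strict Implicit.
Unset Printing Implicit Defensive.

Import Order.TTheory GRing.Theory Num.Theory.

(* Finite simple graphs whose vertices are drawn from an ambient finite type; *)
(* the vertex set is part of the data, so that a subgraph may drop vertices   *)
(* as well as edges. An edge is a two-element set of vertices.                *)
Definition graph_axiom (T : finType) (V : {set T}) (E : {set {set T}}) : bool :=
  [forall e in E, (e \subset V) && (#|e| == 2)].

Record graph (T : finType) := Graph {
  vertices : {set T};
  edges : {set {set T}};
  graphP : graph_axiom vertices edges
}.

Definition subgraph (T : finType) (H G : graph T) : bool :=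
  (vertices H \subset vertices G) && (edges H \subset edges G).

Lemma induced_axiom (T : finType) (G : graph T) (S : {set T}) :
  graph_axiom (S :&: vertices G) [set e in edges G | e \subset S].
Proof.
apply/forall_inP => e; rewrite inE => /andP[eE eS].
by have /andP[eV ->] := forall_inP (graphP G) e eE; rewrite subsetI eS eV.
Qed.

Definition induced (T : finType) (G : graph T) (S : {set T}) : graph T :=
  Graph (induced_axiom G S).

Definition degree (T : finType) (G : graph T) (x : T) : nat :=
  #|[set e in edges G | x \in e]|.

Definition vertex_cover (T : finType) (G : graph T) (C : {set T}) : bool :=
  (C \subset vertices G) && [forall e in edges G, C :&: e != set0].

Lemma vertices_cover (T : finType) (G : graph T) : vertex_cover G (vertices G).
Proof.
rewrite /vertex_cover subxx; apply/forall_inP => e eE.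
have /andP[/setIidPr -> /eqP e2] := forall_inP (graphP G) e eE.
by rewrite -card_gt0 e2.
Qed.

Definition OPT (T : finType) (G : graph T) : nat :=
  #|[arg min_(C < vertices G | vertex_cover G C) #|C|]|.

Lemma OPT_spec (T : finType) (G : graph T) :
  (exists2 C, vertex_cover G C & #|C| = OPT G) /\
  (forall C, vertex_cover G C -> OPT G <= #|C|).
Proof.
rewrite /OPT; case: arg_minnP => [|C CG Cmin]; first exact: vertices_cover.
by split=> //; exists C.
Qed.

(* A set of edges is a forest if it contains no cycle x_1, ..., x_n of        *)
(* distinct vertices with n >= 3. Such cycles have n <= #|T|, which makes the *)
(* property decidable; forestP removes the bound.                             *)
Definition forest (T : finType) (F : {set {set T}}) : bool :=
  [forall n : 'I_#|T|.+1, forall c : n.-tuple T,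
     (2 < n) ==> ~~ ucycleb [rel x y | [set x; y] \in F] c].

Lemma forestP (T : finType) (F : {set {set T}}) :
  reflect (forall c : seq T, 2 < size c -> ~ ucycle [rel x y | [set x; y] \in F] c)
          (forest F).
Proof.
apply: (iffP forallP) => [Ff c c2 cF | Ff n].
  have /andP[_ cu] := cF.
  have cT : size c < #|T|.+1 by rewrite ltnS -(card_uniqP cu) max_card.
  have /forallP/(_ (in_tuple c)) := Ff (Ordinal cT).
  by rewrite /= c2 /= => /negP; apply.
apply/forallP => c; apply/implyP => n2; apply/negP.
by apply: Ff; rewrite size_tuple.
Qed.

(* The set of blocks P splits the edges of G into #|P| forests.               *)
Definition forest_partition (T : finType) (G : graph T) (P : {set {set {set T}}}) : bool :=
  partition P (edges G) && [forall F in P, forest F].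

Definition singleton_edges (T : finType) (G : graph T) : {set {set {set T}}} :=
  [set [set e] | e in edges G].

Lemma forest_set1 (T : finType) (e : {set T}) : forest [set e].
Proof.
apply/forestP => -[|x [|y [|z c]]] // _ /andP[/= + /andP[+ _]].
rewrite !inE => /and3P[/eqP exy /eqP eyz _].
rewrite !negb_or => /and3P[xy xz _].
have : x \in [set y; z] by rewrite eyz -exy !inE eqxx.
by rewrite !inE (negPf xy) (negPf xz).
Qed.

Lemma singleton_forest_partition (T : finType) (G : graph T) :
  forest_partition G (singleton_edges G).
Proof.
apply/andP; split; last first.
  by apply/forall_inP => _ /imsetP[e _ ->]; exact: forest_set1.
apply/and3P; split.
- rewrite cover_imset; apply/eqP/setP => e; apply/bigcupP/idP.
    by case=> f fE; rewrite inE => /eqP->.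
  by move=> eE; exists e; rewrite ?inE.
- apply/trivIsetP => _ _ /imsetP[e _ ->] /imsetP[f _ ->] ef.
  by rewrite disjoints1 inE; apply: contraNneq ef => ->.
- by apply/imsetP => -[e _ /setP/(_ e)]; rewrite !inE eqxx.
Qed.

Definition arboricity (T : finType) (G : graph T) : nat :=
  #|[arg min_(P < singleton_edges G | forest_partition G P) #|P|]|.

Lemma arboricity_spec (T : finType) (G : graph T) :
  (exists2 P, forest_partition G P & #|P| = arboricity G) /\
  (forall P, forest_partition G P -> arboricity G <= #|P|).
Proof.
rewrite /arboricity; case: arg_minnP => [|P PG Pmin].
  exact: singleton_forest_partition.
by split=> //; exists P.
Qed.

Local Open Scope ring_scope.

Definition high_vertices (R : realFieldType) (T : finType) (G : graph T) (L : R) : {set T} :=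
  [set x in vertices G | L < (degree G x)%:R].

Definition low_subgraph (R : realFieldType) (T : finType) (G : graph T) (L : R) : graph T :=
  induced G [set x in vertices G | (degree G x)%:R <= L].

Definition approx_vertex_cover (R : realFieldType) (T : finType) (beta zeta : R)
    (H : graph T) (C : {set T}) : Prop :=
  vertex_cover H C /\ #|C|%:R <= beta * (OPT H)%:R + zeta.

(* Main.v *)
Require Import Defs.
From mathcomp Require Import all_boot all_order all_algebra.
From mathcomp Require Import ring lra.

Set Implicit Arguments.
Unset Strict Implicit.
Unset Printing Implicit Defensive.

Import Order.TTheory GRing.Theory Num.Theory.

(* Fix a minimum vertex cover D of G. As D meets the edges of H, OPT(H) <= *)
(* OPT(G), so only the set X of high vertices outside D has to be counted. X *)
(* is independent and its edges all go to D, so there are at least Lambda |X| *)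
(* edges inside X :|: D, while a union of alpha forests has at most *)
(* alpha (|X| + |D|) edges there. Hence |X| <= eta |D|. *)

(** An edge of [G] with no high endpoint lies in the low subgraph, hence in [H], so [C] covers it
    ([vertex_coverU_high]). For the size, [C] costs at most beta OPT(G) + zeta by [OPT_subgraph],
    and the high vertices at most |D| + |X| ([high_vertices_card]). There [sum_degree_le] bounds the
    degree sum over [X], using the forest count of [card_induced_edges]. *)

Lemma sub_forest (T : finType) (F F' : {set {set T}}) :
  F' \subset F -> forest F -> forest F'.
Proof.
move=> /subsetP sF /forestP Ff; apply/forestP => c c2 /andP[cF' cu].
apply: (Ff c c2); apply/andP; split=> //.
by apply: sub_cycle cF' => x y /= /sF.
Qed.

(* Otherwise a simple path could be prolonged for ever: its end x has an edge *)
(* other than the last one of the path, and that edge leads to a new vertex *)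
(* because F has no cycle. *)
Lemma forest_leaf (T : finType) (F : {set {set T}}) :
  forest F -> {in F, forall e : {set T}, #|e| = 2} -> F != set0 ->
  exists x, #|[set e in F | x \in e]| = 1.
Proof.
move=> /forestP Ff F2 /set0Pn[e0 e0F].
suff : [exists x, #|[set e in F | x \in e]| == 1].
  by case/existsP=> x /eqP xP; exists x.
apply: contraT; rewrite negb_exists => /forallP noleaf.
pose adj := [rel x y | [set x; y] \in F].
have next x y : adj x y -> exists2 z, adj x z & z != y.
  move=> /= xyF.
  have : 1 < #|[set e in F | x \in e]|.
    rewrite ltn_neqAle eq_sym noleaf card_gt0.
    by apply/set0Pn; exists [set x; y]; rewrite !inE xyF eqxx.
  rewrite (cardsD1 [set x; y]) !inE xyF eqxx ltnS card_gt0.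
  case/set0Pn=> e; rewrite !inE => /and3P[exy eF xe].
  have : #|e| == 2 by rewrite F2.
  rewrite (cardsD1 x) xe eqSS => /cards1P[z ez].
  have eE : e = [set x; z] by rewrite -(setD1K xe) ez.
  exists z; first by rewrite /= -eE.
  by apply: contraNneq exy => <-; rewrite eE.
(* The path grows at its head: [x] is the current end and [y] its predecessor. *)
have long n : exists x y p,
    [/\ path adj x (y :: p), uniq [:: x, y & p] & n <= size p].
  elim: n => [|n [x [y [p [xp up np]]]]].
    have /eqP/cards2P[x [y [xy e0E]]] := F2 _ e0F.
    by exists x, y, [::]; split; rewrite ?leq0n /= ?inE ?xy // andbT -e0E e0F.
  have /andP[xy _] := xp; have [z xz zy] := next x y xy.
  have zx : z != x.
    by apply/eqP => zE; have := F2 _ xz; rewrite zE setUid cards1.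
  have adjC a b : adj a b = adj b a by rewrite /adj /= setUC.
  (* If the new neighbour [z] of [x] is already on the path, the stretch from [x] to [z] closes into
     a cycle of length at least 3. *)
  case: (boolP (z \in p)) => [zp|zNp].
    case/splitPr: zp xp up np => p1 p2 xp up np.
    case: (Ff (x :: y :: rcons p1 z)); first by rewrite /= size_rcons.
    move: xp up; rewrite -cat_rcons -2!cat_cons cat_uniq => xp /andP[up _].
    apply/andP; split=> //.
    move: xp; rewrite cat_path => /andP[xp _].
    rewrite /cycle rcons_path.
    apply/andP; split=> //.
    by rewrite /= last_rcons -[_ \in F]/(adj z x) adjC.
  exists z, x, (y :: p); split=> //.
    by rewrite -[path _ _ _]/(adj z x && path adj x (y :: p)) adjC xz.
  by rewrite cons_uniq up andbT !inE !negb_or zx zy.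
have [x [y [p [_ /card_uniqP up np]]]] := long #|T|.
have := max_card [in [:: x, y & p]].
by rewrite up /= leqNgt ltnS leqW.
Qed.

(** Removing a leaf together with its only edge lowers both sides by one. The bound |S| instead of
    |S| - 1 also admits an empty [S]. *)
Lemma card_forest (T : finType) (F : {set {set T}}) (S : {set T}) :
  forest F -> {in F, forall e : {set T}, #|e| = 2} ->
  {in F, forall e : {set T}, e \subset S} ->
  #|F| <= #|S|.
Proof.
elim: {S}#|S| {-2}S (erefl #|S|) F => [|n IHn] S Sn F Ff F2 FS.
  rewrite Sn leqn0 cards_eq0.
  apply: contraT => /set0Pn[e eF].
  by have := subset_leq_card (FS e eF); rewrite F2 // Sn.
have [->|F0] := eqVneq F set0; first by rewrite cards0.
have [x /eqP/cards1P[e xe]] := forest_leaf Ff F2 F0.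
have /andP[eF xine] : (e \in F) && (x \in e).
  by have /setP/(_ e) := xe; rewrite !inE eqxx.
have xS : x \in S by apply: subsetP (FS e eF) _ xine.
have Sn' : #|S :\ x| = n by move: Sn; rewrite (cardsD1 x) xS => -[].
rewrite Sn (cardsD1 e) eF ltnS -Sn'; apply: IHn => //.
- exact: sub_forest (subD1set _ _) Ff.
- by move=> f /setD1P[_ /F2].
- move=> f /setD1P[fe fF]; rewrite subsetD1 FS //=.
  by apply: contra fe => xf; rewrite -in_set1 -xe inE fF.
Qed.

Lemma card_edge (T : finType) (G : graph T) (e : {set T}) :
  e \in edges G -> #|e| = 2.
Proof. by move=> eG; have /andP[_ /eqP] := forall_inP (graphP G) e eG. Qed.

Lemma edge_sub (T : finType) (G : graph T) (e : {set T}) :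
  e \in edges G -> e \subset vertices G.
Proof. by move=> eG; have /andP[] := forall_inP (graphP G) e eG. Qed.

Lemma card_induced_edges (T : finType) (G : graph T) (S : {set T}) :
  #|[set e in edges G | e \subset S]| <= arboricity G * #|S|.
Proof.
have [[P /andP[partP /forall_inP forP] <-] _] := arboricity_spec G.
rewrite -sum1dep_card (set_partition_big_cond _ partP) -sum_nat_const /=.
apply: leq_sum => F FP; rewrite sum1dep_card.
have FG e : e \in F -> e \in edges G.
  by rewrite -(cover_partition partP) => eF; apply/bigcupP; exists F.
apply: card_forest => [|e|e]; rewrite ?inE.
- by apply: sub_forest (forP F FP); apply/subsetP => e; rewrite inE => /andP[].
- by case/andP=> /FG/card_edge.
- by case/andP.
Qed.

(** Double counting: every edge has an endpoint in [D], outside [X], so it is counted at most once,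
    and if counted it lies inside [X :|: D]. *)
Lemma sum_degree_le (T : finType) (G : graph T) (D X : {set T}) :
  vertex_cover G D -> [disjoint X & D] ->
  \sum_(x in X) degree G x <= arboricity G * (#|X| + #|D|).
Proof.
move=> /andP[_ /forall_inP covD] XD.
apply: (@leq_trans (arboricity G * #|X :|: D|)); last first.
  by rewrite leq_mul2l cardsU leq_subr orbT.
apply: leq_trans (card_induced_edges G (X :|: D)).
have degE x : degree G x = \sum_(e in edges G) (x \in e).
  by rewrite /degree -sum1dep_card big_mkcondr.
rewrite (eq_bigr _ (fun x _ => degE x)) exchange_big /= -sum1dep_card.
rewrite big_mkcondr /=; apply: leq_sum => e eG.
have -> : \sum_(x in X) (x \in e) = #|X :&: e|.
  by rewrite -sum1_card -big_mkcondr; apply: eq_bigl => x; rewrite inE.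
have /set0Pn[d /setIP[dD de]] := covD e eG.
have dX : d \notin X by apply: contraL dD => dX; rewrite (disjointFr XD).
have : #|e| == 2 by rewrite (card_edge eG).
rewrite (cardsD1 d) de eqSS => /cards1P[y eE].
have {}eE : e = [set d; y] by rewrite -(setD1K de) eE.
have sub : X :&: e \subset [set y].
  apply/subsetP => x; rewrite eE !inE => /andP[xX /orP[/eqP xd|//]].
  by rewrite -xd xX in dX.
case: (boolP (y \in X)) => yX.
  rewrite eE subUset !sub1set !inE dD yX orbT /= -eE.
  by rewrite -(cards1 y) subset_leq_card.
rewrite (_ : X :&: e = set0) ?cards0 //; apply/eqP; rewrite -subset0.
apply/subsetP => x xXe; have := subsetP sub x xXe; rewrite inE => /eqP xy.
by move: xXe; rewrite inE xy (negPf yX).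
Qed.

(** A cover of [G] must be cut down to the vertices of [H]; it still meets the edges of [H], which
    lie there. *)
Lemma OPT_subgraph (T : finType) (H G : graph T) :
  subgraph H G -> OPT H <= OPT G.
Proof.
move=> /andP[_ /subsetP sE].
have [[D /andP[_ /forall_inP covD] <-] _] := OPT_spec G.
apply: leq_trans (subset_leq_card (subsetIl D (vertices H))).
apply: (OPT_spec H).2; rewrite /vertex_cover subsetIr /=.
apply/forall_inP => e eH.
by rewrite -setIA (setIidPr (edge_sub eH)) covD ?sE.
Qed.

Local Open Scope ring_scope.

Lemma high_vertices_card (R : realFieldType) (T : finType) (G : graph T)
    (eta alpha : R) :
  0 < eta -> (arboricity G)%:R <= alpha ->
  #|high_vertices G ((1 + 1 / eta) * (2 * alpha))|%:R
    <= (1 + eta) * (OPT G)%:R.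
Proof.
move=> eta0 ar; set L := _ * _; set V := high_vertices G L.
have [[D covD Dopt] _] := OPT_spec G.
set X := V :\: D.
have XD : [disjoint X & D].
  by rewrite -setI_eq0 /X setDE -setIA [_ :&: D]setIC setICr setI0.
have degX x : x \in X -> L < (degree G x)%:R by rewrite !inE => /and3P[].
have alpha0 : 0 <= alpha by apply: le_trans ar.
have sumX : (\sum_(x in X) degree G x)%:R <= alpha * (#|X|%:R + #|D|%:R) :> R.
  apply: (@le_trans _ _ (arboricity G * (#|X| + #|D|))%:R).
    by rewrite ler_nat sum_degree_le.
  by rewrite natrM natrD ler_wpM2r // addr_ge0.
have XleD : #|X|%:R <= eta * #|D|%:R :> R.
  have [->|/set0Pn[x0 x0X]] := eqVneq X set0.
    by rewrite cards0 mulr_ge0 // ltW.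
  (* Strict because [X] has an element [x0]; strictness then rules out alpha = 0, so alpha can be
     cancelled. *)
  have LX : L * #|X|%:R < alpha * (#|X|%:R + #|D|%:R).
    apply: lt_le_trans sumX; rewrite mulr_natr -sumr_const natr_sum.
    rewrite (bigD1 x0) //= [ltRHS](bigD1 x0) //= ltr_leD ?degX //.
    by apply: ler_sum => x /andP[/degX/ltW].
  have alpha_gt0 : 0 < alpha.
    rewrite lt0r alpha0 andbT; apply: contraTneq LX => a0.
    by rewrite /L a0 !(mulr0, mul0r) ltxx.
  have : (1 + 1 / eta) * 2 * #|X|%:R < #|X|%:R + #|D|%:R.
    by rewrite -(ltr_pM2l alpha_gt0) (le_lt_trans _ LX) // /L; lra.
  (* Clearing the denominator gives (eta + 2)|X| < eta |D|, more than is needed. *)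
  rewrite -(ltr_pM2l eta0).
  have -> : eta * ((1 + 1 / eta) * 2 * #|X|%:R) = 2 * (eta + 1) * #|X|%:R.
    by field; rewrite gt_eqF.
  have : 0 <= eta * #|X|%:R by rewrite mulr_ge0 // ltW.
  have : 0 <= #|X|%:R :> R by [].
  by lra.
have : #|V|%:R <= #|D|%:R + #|X|%:R :> R.
  rewrite -natrD ler_nat -(cardsID D V) leq_add2r.
  by rewrite subset_leq_card // subsetIr.
by rewrite -Dopt; lra.
Qed.

Lemma vertex_coverU_high (R : realFieldType) (T : finType) (G H : graph T)
    (L : R) (C : {set T}) :
  subgraph (low_subgraph G L) H -> subgraph H G -> vertex_cover H C ->
  vertex_cover G (C :|: high_vertices G L).
Proof.
move=> /andP[_ /subsetP sLH] /andP[sV _] /andP[CH /forall_inP covC].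
apply/andP; split.
  rewrite subUset (subset_trans CH sV) /=.
  by apply/subsetP => x; rewrite inE => /andP[].
apply/forall_inP => e eG; rewrite setIUl setU_eq0 negb_and.
case: (boolP (high_vertices G L :&: e == set0)) => [/eqP he|_];
  last by rewrite orbT.
rewrite orbF covC // sLH // inE eG /=; apply/subsetP => x xe.
have xG := subsetP (edge_sub eG) x xe.
rewrite inE xG /= leNgt; apply/negP => Lx.
by have /setP/(_ x) := he; rewrite !inE xG Lx xe.
Qed.

Theorem mainTheorem12 (R : realFieldType) (T : finType) (G H : graph T)
    (eta alpha beta zeta : R) (C : {set T}) :
  let Lambda := (1 + 1 / eta) * (2 * alpha) in
  0 < eta ->
  0 <= beta ->
  (arboricity G)%:R <= alpha ->
  subgraph (low_subgraph G Lambda) H ->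
  subgraph H G ->
  approx_vertex_cover beta zeta H C ->
  vertex_cover G (C :|: high_vertices G Lambda) /\
  #|C :|: high_vertices G Lambda|%:R <= (1 + beta + eta) * (OPT G)%:R + zeta.
Proof.
move=> Lambda eta0 beta0 ar sLH sHG [covC cardC].
split; first exact: vertex_coverU_high sLH sHG covC.
have Vcard := high_vertices_card eta0 ar.
have optHG : beta * (OPT H)%:R <= beta * (OPT G)%:R.
  by rewrite ler_wpM2l // ler_nat OPT_subgraph.
have : #|C :|: high_vertices G Lambda|%:R
    <= #|C|%:R + #|high_vertices G Lambda|%:R :> R.
  by rewrite -natrD ler_nat cardsU leq_subr.
by move: Vcard; rewrite -/Lambda; lra.
Qed.
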